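(* Every fractionally tree-independence-number-fragile graph class is polynomially $(\mathsf{dgn},\omega)$-bounded.
   Context: All graphs are finite and simple. $\omega(G)$ is the clique number and $\alpha(G)$ the independence number of $G$. The degeneracy $\mathsf{dgn}(G)$ of a nonnull graph $G$ is the maximum, over nonnull induced subgraphs $H$ of $G$, of the minimum degree of $H$. A graph class $\mathcal{G}$ is polynomially $(\mathsf{dgn},\omega)$-bounded if there is a polynomial function $f$ such that $\mathsf{dgn}(H)\le f(\omega(H))$ for every $G\in\mathcal{G}$ and every (nonnull) induced subgraph $H$ of $G$. A tree decomposition of $G$ is a pair $(T,\{X_t\}_{t\in V(T)})$ with $T$ a tree and bags $X_t\subseteq V(G)$ such that every vertex is in some bag, both endpoints of every edge lie in a common bag, and for each $u\in V(G)$ the nodes $t$ with $u\in X_t$ induce a connected subgraph of $T$. The tree-independence number of $G$ is the minimum over tree decompositions of $\max_t\alpha(G[X_t])$. For $\beta\le 1$, a $\beta$-general cover of $G$ is a multiset $\mathcal{C}$ of subsets of $V(G)$ such that each vertex belongs to at least $\beta|\mathcal{C}|$ elements of $\mathcal{C}$. A class $\mathcal{G}$ is fractionally tree-independence-number-fragile if there is a function $f\colon\mathbb{N}\to\mathbb{N}$ such that, for every $r\in\mathbb{N}$, every $G\in\mathcal{G}$ has a $(1-1/r)$-general cover $\mathcal{C}$ such that $G[C]$ has tree-independence number at most $f(r)$ for every $C\in\mathcal{C}$. Here $\mathbb{N}=\{1,2,3,\ldots\}$, and covers are nonempty finite multisets. *)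

(* Defs.v *)
From mathcomp Require Import all_boot all_order all_algebra.
From mathcomp Require Import boolp reals.
Set Implicit Arguments.
Unset Strict Implicit.
Unset Printing Implicit Defensive.
Import Order.TTheory GRing.Theory Num.Theory.

(** * Finite simple graphs *)

Record sgraph := SGraph {
  vertex :> finType;
  adj : rel vertex;
  adj_sym : symmetric adj;
  adj_irrefl : irreflexive adj }.
Arguments adj {s} x y : rename.

Lemma induced_sym (G : sgraph) (S : {set G}) :
  symmetric (fun x y : {z : G | z \in S} => adj (val x) (val y)).
Proof. by move=> x y; apply: adj_sym. Qed.

Lemma induced_irrefl (G : sgraph) (S : {set G}) :
  irreflexive (fun x y : {z : G | z \in S} => adj (val x) (val y)).
Proof. by move=> x; apply: adj_irrefl. Qed.

Definition induced (G : sgraph) (S : {set G}) : sgraph :=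
  SGraph (@induced_sym G S) (@induced_irrefl G S).

Definition clique (G : sgraph) (A : {set G}) : bool :=
  [forall x in A, forall y in A, (x != y) ==> adj x y].

Definition independent (G : sgraph) (A : {set G}) : bool :=
  [forall x in A, forall y in A, ~~ adj x y].

Definition clique_number (G : sgraph) : nat :=
  \max_(A : {set G} | clique A) #|A|.

Definition independence_number (G : sgraph) : nat :=
  \max_(A : {set G} | independent A) #|A|.

Definition degree (G : sgraph) (x : G) : nat := #|[set y : G | adj x y]|.

(* Every degree is smaller than #|G|, so the default value #|G| of the iterated
   minimum only matters for the null graph. *)
Definition min_degree (G : sgraph) : nat :=
  \big[minn/#|G|]_(x : G) degree x.

Definition degeneracy (G : sgraph) : nat :=
  \max_(S : {set G} | S != set0) min_degree (induced S).

Definition graph_class := sgraph -> Prop.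

(* The null induced subgraph, whose degeneracy is undefined, is excluded. *)
Definition poly_dgn_omega_bounded (R : realType) (GG : graph_class) : Prop :=
  exists p : {poly R}, forall G : sgraph, GG G ->
    forall S : {set G}, S != set0 ->
      ((degeneracy (induced S))%:R <= p.[(clique_number (induced S))%:R])%R.

(** * Tree decompositions *)

Definition connected_graph (G : sgraph) : Prop :=
  forall x y : G, connect adj x y.

(* [ucycle] also accepts the lists of length 0 and, for every edge xy, the list
   [:: x; y], neither of which is a cycle of the graph. *)
Definition acyclic_graph (G : sgraph) : Prop :=
  forall c : seq G, ucycle adj c -> size c <= 2.

Definition is_tree (T : sgraph) : Prop :=
  [/\ 0 < #|T|, connected_graph T & acyclic_graph T].

Definition tree_decomposition (G T : sgraph) (X : T -> {set G}) : Prop :=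
  [/\ is_tree T,
      forall u : G, exists t : T, u \in X t,
      forall u v : G, adj u v -> exists t : T, (u \in X t) && (v \in X t)
    & forall u : G, connected_graph (induced [set t : T | u \in X t])].

Definition decomposition_independence (G T : sgraph) (X : T -> {set G}) : nat :=
  \max_(t : T) independence_number (induced (X t)).

Definition attained_independence (G : sgraph) : pred nat :=
  fun k => `[< exists (T : sgraph) (X : T -> {set G}),
                 tree_decomposition X /\ decomposition_independence X = k >].

Lemma unit_adj_sym : symmetric (fun _ _ : unit => false).
Proof. by []. Qed.

Lemma unit_adj_irrefl : irreflexive (fun _ : unit => fun _ => false).
Proof. by []. Qed.

Definition single_node : sgraph := SGraph unit_adj_sym unit_adj_irrefl.

Lemma attained_independence_ex (G : sgraph) :
  exists k, attained_independence G k.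
Proof.
exists (decomposition_independence (fun _ : single_node => [set: G])).
apply/asboolP; exists single_node, (fun=> setT); split=> //; split.
- split; first by rewrite card_unit.
    by move=> [] []; apply: connect0.
  move=> c /andP[_ /card_uniqP <-].
  by rewrite (leq_trans (max_card _)) // card_unit.
- by move=> u; exists tt; rewrite in_setT.
- by move=> u v _; exists tt; rewrite !in_setT.
- move=> u [[] p] [[] q]; rewrite (_ : exist _ tt p = exist _ tt q).
    exact: connect0.
  exact: val_inj.
Qed.

Definition tree_independence_number (G : sgraph) : nat :=
  ex_minn (attained_independence_ex G).

(** * Fractional fragility *)

(* A finite multiset of vertex sets is given by a list of its elements with
   their multiplicities; the order is irrelevant to all notions below. *)
Definition general_cover (R : realType) (beta : R) (G : sgraph)
    (C : seq {set G}) : Prop :=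
  C <> [::] /\
  forall v : G,
    (beta * (size C)%:R <= (count (fun A : {set G} => v \in A) C)%:R)%R.

(* Both r and f r range over the positive integers. *)
Definition frac_tree_independence_fragile (R : realType) (GG : graph_class) :
    Prop :=
  exists f : nat -> nat, (forall r, 0 < r -> 0 < f r) /\
    forall r : nat, 0 < r -> forall G : sgraph, GG G ->
      exists C : seq {set G},
        general_cover (1 - r%:R^-1 : R)%R C /\
        (forall A : {set G}, A \in C ->
           tree_independence_number (induced A) <= f r).

(* Main.v *)
Require Import Defs.
From mathcomp Require Import all_boot all_order all_algebra.
From mathcomp Require Import boolp reals.
From mathcomp Require Import zify lra.
Set Implicit Arguments.
Unset Strict Implicit.
Unset Printing Implicit Defensive.
Import Order.TTheory GRing.Theory Num.Theory.

(** In a tree decomposition of a nonnull graph some vertex has all its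
    neighbours in one bag; if bags have independence number at most [k] and
    cliques have size at most [w], Ramsey's theorem bounds its degree by
    [d = (w + 1) ^ k].  Hence a graph on [n] vertices with tree-independence
    number at most [k] has at most [d * n] edges.  Take a 3/4-general cover by
    such graphs and a vertex set [B] of the whole graph: every edge inside [B]
    lies in at least half of the elements of the cover, so [B] spans at most
    [2 * d * #|B|] edges and contains a vertex with at most [4 * d] neighbours
    in [B]. *)

(** * Neighbourhoods and a Ramsey bound *)

Definition nbhd (G : sgraph) (B : {set G}) (x : G) : {set G} :=
  [set y in B | adj x y].

Lemma cliqueP (G : sgraph) (A : {set G}) :
  reflect {in A &, forall x y, x != y -> adj x y} (clique A).
Proof.
apply: (iffP 'forall_in_forall_inP) => cl x.
  by move=> y xA yA; apply/implyP; apply: cl.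
by move=> xA y yA; apply/implyP; apply: cl.
Qed.

Lemma independentP (G : sgraph) (A : {set G}) :
  reflect {in A &, forall x y, ~~ adj x y} (independent A).
Proof.
by apply: (iffP 'forall_in_forall_inP) => ind x => [y xA yA|xA y yA]; apply: ind.
Qed.

(** Split [A] at a vertex [x]: its neighbours admit only smaller cliques, its non-neighbours only
    smaller independent sets. For fixed [k] the bound is polynomial in [w]. *)
Lemma ramsey_bound (G : sgraph) (k w : nat) (A : {set G}) :
  (forall B : {set G}, B \subset A -> clique B -> #|B| <= w) ->
  (forall B : {set G}, B \subset A -> independent B -> #|B| <= k) ->
  #|A| < w.+1 ^ k.
Proof.
elim: k w A => [|k IHk] w A.
  move=> _ indA; rewrite expn0 ltnS leqn0 cards_eq0.
  apply/set0Pn => -[x xA]; suff : #|[set x]| <= 0 by rewrite cards1.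
  apply: indA; first by rewrite sub1set.
  by apply/independentP=> y z /set1P-> /set1P->; rewrite adj_irrefl.
elim: w A => [|w IHw] A clA indA.
  rewrite exp1n ltnS leqn0 cards_eq0.
  apply/set0Pn => -[x xA]; suff : #|[set x]| <= 0 by rewrite cards1.
  apply: clA; first by rewrite sub1set.
  by apply/cliqueP=> y z /set1P-> /set1P->; rewrite eqxx.
have [->|/set0Pn[x xA]] := eqVneq A set0; first by rewrite cards0 expn_gt0.
set N := nbhd A x; set M := A :\ x :\: N.
have NA : N \subset A by apply/subsetP=> y; rewrite inE => /andP[].
have MA : M \subset A.
  by apply/subsetP=> y; rewrite !inE => /andP[_ /andP[]].
have cN : #|N| < w.+1 ^ k.+1.
  apply: IHw => B BN; last by apply: indA; apply: subset_trans NA.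
  move=> /cliqueP clB; have xB : x \notin B.
    by apply/negP=> /(subsetP BN); rewrite inE adj_irrefl andbF.
  suff : #|x |: B| <= w.+1 by rewrite cardsU1 xB.
  apply: clA; first by rewrite subUset sub1set xA (subset_trans BN).
  apply/cliqueP=> y z /setU1P[->|yB] /setU1P[->|zB]; last exact: clB.
  - by rewrite eqxx.
  - by move: (subsetP BN _ zB); rewrite inE => /andP[].
  - by rewrite adj_sym; move: (subsetP BN _ yB); rewrite inE => /andP[].
have cM : #|M| < w.+2 ^ k.
  apply: IHk => B BM; first by apply: clA; apply: subset_trans MA.
  have BMx y : y \in B -> ~~ adj x y.
    move/(subsetP BM); rewrite !inE => /andP[yN /andP[_ yA]].
    by move: yN; rewrite yA.
  move=> /independentP indB; have xB : x \notin B.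
    by apply/negP=> /(subsetP BM); rewrite !inE eqxx andbF.
  suff : #|x |: B| <= k.+1 by rewrite cardsU1 xB.
  apply: indA; first by rewrite subUset sub1set xA (subset_trans BM).
  apply/independentP=> y z /setU1P[->|yB] /setU1P[->|zB]; last exact: indB.
  - by rewrite adj_irrefl.
  - exact: BMx.
  - by rewrite adj_sym; apply: BMx.
have cA : #|A| = (#|N| + #|M|).+1.
  have NAx : N \subset A :\ x.
    apply/subsetP=> y yN; rewrite in_setD1 (subsetP NA _ yN) andbT.
    by apply: contraTneq yN => ->; rewrite inE adj_irrefl andbF.
  by rewrite (cardsD1 x A) xA -(cardsID N (A :\ x)) (setIidPr NAx).
(* Hence [w.+1 ^ k.+1 <= w.+1 * w.+2 ^ k], and adding [w.+2 ^ k] gives at most [w.+2 ^ k.+1]. *)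
have le_pow : w.+1 ^ k <= w.+2 ^ k by case: (k) => // j; rewrite leq_exp2r.
by rewrite cA; move: cN cM; rewrite !expnS; nia.
Qed.

(** * Transfer between a graph and its induced subgraphs *)

Definition restrict_set (G : sgraph) (S B : {set G}) : {set induced S} :=
  [set z | val z \in B].

Lemma card_restrict_set (G : sgraph) (S B : {set G}) :
  B \subset S -> #|restrict_set S B| = #|B|.
Proof.
move=> BS; rewrite -(card_imset (mem (restrict_set S B)) val_inj).
apply: eq_card => x; apply/imsetP/idP => [[z zB ->]|xB].
  by rewrite inE in zB.
by exists (exist _ x (subsetP BS _ xB)); rewrite ?inE.
Qed.

Lemma clique_le_induced (G : sgraph) (S B : {set G}) :
  B \subset S -> clique B -> #|B| <= clique_number (induced S).
Proof.
move=> BS /cliqueP clB; rewrite -(card_restrict_set BS).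
apply: (@leq_bigmax_cond _ _ (fun A : {set induced S} => #|A|)).
by apply/cliqueP=> x y; rewrite !inE => xB yB; apply: clB.
Qed.

Lemma independent_le_induced (G : sgraph) (S B : {set G}) :
  B \subset S -> independent B -> #|B| <= independence_number (induced S).
Proof.
move=> BS /independentP indB; rewrite -(card_restrict_set BS).
apply: (@leq_bigmax_cond _ _ (fun A : {set induced S} => #|A|)).
by apply/independentP=> x y; rewrite !inE => xB yB; apply: indB.
Qed.

Lemma card_nbhd_induced (G : sgraph) (S : {set G}) (B : {set induced S})
    (x : induced S) :
  #|nbhd B x| = #|nbhd (val @: B) (val x)|.
Proof.
rewrite -(card_imset (mem (nbhd B x)) val_inj).
apply: eq_card => y; rewrite inE; apply/imsetP/andP.
  by case=> z; rewrite inE => /andP[zB xz] ->; rewrite imset_f.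
by case=> /imsetP[z zB ->] xz; exists z; rewrite // inE zB.
Qed.

(** * Connectivity and leaves in the decomposition tree *)

(* Connectedness stated by cuts passes to [Z :\ l] for a leaf [l] without any
   manipulation of paths. *)
Definition cut_connected (T : sgraph) (Z : {set T}) : Prop :=
  forall B : {set T}, B \subset Z -> B != set0 -> B != Z ->
    exists s t : T, [/\ s \in B, t \in Z :\: B & adj s t].

(** If no edge left [B] inside [Z], then [B] would be closed under reachability in [induced Z]. *)
Lemma connected_cut (T : sgraph) (Z : {set T}) :
  connected_graph (induced Z) -> cut_connected Z.
Proof.
move=> conZ B BZ /set0Pn[b bB] BnZ.
have [c cZ] : exists c, c \in Z :\: B.
  by apply/set0Pn; rewrite setD_eq0; apply: contraNN BnZ => ZB; rewrite eqEsubset BZ.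
apply: contrapT => nocut.
have cl : closed (@adj (induced Z)) (restrict_set Z B).
  apply: intro_closed; first exact: (sym_connect_sym (@adj_sym (induced Z))).
  move=> x y xy; rewrite !inE => xB; apply: contraT => yB.
  case: nocut; exists (val x), (val y); split=> //.
  by rewrite inE yB (valP y).
move: cZ; rewrite inE => /andP[cB cZ].
have := closed_connect cl (conZ (exist _ b (subsetP BZ _ bB)) (exist _ c cZ)).
by rewrite !inE /= bB (negbTE cB).
Qed.

(** Degree at most one in [W], so an isolated node counts as a leaf. *)
Definition leaf_in (T : sgraph) (W : {set T}) (l : T) : Prop :=
  l \in W /\ {in nbhd W l &, forall p q, p = q}.

(* The end of a longest path in [W] is a leaf. *)
Lemma acyclic_leaf (T : sgraph) (W : {set T}) :
  acyclic_graph T -> W != set0 -> exists l, leaf_in W l.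
Proof.
move=> acT /set0Pn[w wW].
pose is_path (s : seq T) := [&& uniq s, all (mem W) s & sorted adj s].
pose P n := [exists s : n.-tuple T, is_path s].
have PS s : is_path s -> P (size s).
  by move=> ps; apply/existsP; exists (in_tuple s).
have exP : exists n, P n by exists (size [:: w]); apply: PS; rewrite /is_path /= wW.
have boundP n : P n -> n <= #|T|.
  case/existsP=> s /and3P[/card_uniqP sz _ _].
  by rewrite -(size_tuple s) -sz max_card.
case: (ex_maxnP exP boundP) => m /existsP[s ps] maxm.
case Ds: (tval s) ps => [|l p] ps.
  suff : 1 <= m by rewrite -(size_tuple s) Ds.
  by apply: (maxm (size [:: w])); apply: PS; rewrite /is_path /= wW.
have /and3P[ups Wps lp] := ps.
have lW : l \in W by case/andP: Wps.
exists l; split=> //.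
suff nbr_head a : a \in nbhd W l -> a = head l p by move=> a b /nbr_head-> /nbr_head->.
rewrite inE => /andP[aW la].
have al : a != l by apply: contraTneq la => ->; rewrite adj_irrefl.
(* Otherwise [a] would extend the longest path. *)
have ap : a \in p.
  apply: contraT => ap; suff : m < m by rewrite ltnn.
  rewrite -{1}(size_tuple s) Ds -/(size (a :: l :: p)); apply/maxm/PS.
  rewrite /is_path [uniq _]/= inE negb_or al ap [all _ _]/= aW.
  by move: ups Wps lp => /= -> -> ->; rewrite adj_sym la.
case: p ap Ds ps ups Wps lp => [//|b p'] ap _ _ ups _ lp /=.
move: ap; rewrite inE => /predU1P[//|ap].
case/splitPr: ap ups lp => p1 p2 ups lp.
(* A neighbour beyond the second node [b] closes a cycle of length at least 3. *)
suff : size (l :: b :: rcons p1 a) <= 2 by rewrite /= size_rcons.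
apply: acT; rewrite /ucycle; apply/andP; split.
  have : path adj l (rcons (b :: p1) a).
    by move: lp; rewrite /= -cat_rcons cat_path => /and3P[-> ->].
  rewrite /cycle -rcons_cons [path _ _ (rcons (rcons _ _) _)]rcons_path => ->.
  by rewrite last_rcons adj_sym la.
by move: ups; rewrite -cat_rcons -!cat_cons cat_uniq => /andP[].
Qed.

(** If [B] contains a neighbour of [l], cut along [l |: B]: the edge found cannot start at [l],
    whose only neighbour is in [B]. Otherwise cut along [B]: the edge found cannot end at [l]. *)
Lemma cut_connected_leaf (T : sgraph) (W Z : {set T}) (l : T) :
  leaf_in W l -> Z \subset W -> cut_connected Z -> cut_connected (Z :\ l).
Proof.
move=> [lW leafl] ZW conZ B BZ Bn0 BnZ.
have lB : l \notin B by apply/negP=> /(subsetP BZ); rewrite !inE eqxx.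
have BZ' : B \subset Z by apply: subset_trans BZ (subsetDl _ _).
have nbrl p : p \in Z -> adj p l -> p \in nbhd W l.
  by move=> pZ pl; rewrite inE (subsetP ZW) // adj_sym.
have [lZ|lZ] := boolP (l \in Z); last first.
  have ZD : Z :\ l = Z.
    by apply/setP=> x; rewrite !inE; case: eqVneq => // ->; rewrite (negbTE lZ).
  by rewrite ZD in BnZ *; apply: conZ.
have [[p pB pl]|nop] := pselect (exists2 p, p \in B & adj p l); last first.
  have BnZl : B != Z by apply: contraNneq lB => ->.
  have [s [t [sB]]] := conZ B BZ' Bn0 BnZl.
  rewrite inE => /andP[tB tZ] st; exists s, t; split=> //.
  rewrite !inE tB tZ !andbT; apply/eqP=> tl.
  by case: nop; exists s; rewrite // -tl.
have [s [t []]] : exists s t : T, [/\ s \in l |: B, t \in Z :\: (l |: B) & adj s t].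
  apply: conZ.
  - by rewrite subUset sub1set lZ.
  - by apply/set0Pn; exists l; rewrite setU11.
  - by apply: contraNneq BnZ => <-; rewrite setU1K.
rewrite !inE negb_or => sB /andP[/andP[tl tB] tZ] st.
exists s, t; rewrite !inE tl tB tZ; split=> //.
case/predU1P: sB => // sl; rewrite {}sl in st.
have tp : t = p.
  by apply: leafl; apply: nbrl => //; [rewrite adj_sym | apply: (subsetP BZ')].
by rewrite tp pB in tB.
Qed.

(** This is the cut around the single node [l]. *)
Lemma cut_connected_leaf_nbr (T : sgraph) (W Z : {set T}) (l t : T) :
  leaf_in W l -> Z \subset W -> cut_connected Z -> l \in Z -> t \in Z ->
  t != l -> exists2 p, p \in Z & p \in nbhd W l.
Proof.
move=> [lW _] ZW conZ lZ tZ tl.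
have [x [p [/set1P->]]] : exists x p : T, [/\ x \in [set l], p \in Z :\: [set l] & adj x p].
  apply: conZ; first by rewrite sub1set.
    by apply/set0Pn; exists l; rewrite set11.
  by apply: contraNneq tl => Zl; rewrite -in_set1 Zl.
by rewrite !inE => /andP[_ pZ] lp; exists p; rewrite // inE (subsetP ZW).
Qed.

(* Deleting a leaf node of the decomposition preserves the hypotheses unless
   some vertex of [A] is in the leaf bag only. *)
Lemma simplicial_bag (G T : sgraph) (X : T -> {set G}) (W : {set T})
    (A : {set G}) :
  acyclic_graph T -> A != set0 ->
  {in A, forall u, exists2 t, t \in W & u \in X t} ->
  {in A &, forall u v, adj u v ->
     exists2 t, t \in W & (u \in X t) && (v \in X t)} ->
  {in A, forall u, cut_connected [set t in W | u \in X t]} ->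
  exists2 v, v \in A & exists t, nbhd A v \subset X t.
Proof.
move=> acT An0; have [n] := ubnP #|W|.
elim: n W => // n IHn W cW covV covE conX.
have Wn0 : W != set0.
  have /set0Pn[a aA] := An0; have [t tW _] := covV a aA.
  by apply/set0Pn; exists t.
have [l leafl] := acyclic_leaf acT Wn0; have [lW uniql] := leafl.
(* A vertex whose only bag is [X l] meets all its neighbours there. *)
have [[v [vA vl vonly]]|shared] := pselect (exists v, [/\ v \in A, v \in X l &
    forall t, t \in W -> v \in X t -> t = l]).
  exists v => //; exists l; apply/subsetP=> u; rewrite inE => /andP[uA vu].
  by have [t tW /andP[/(vonly t tW)-> ->]] := covE v u vA uA vu.
have other v : v \in A -> v \in X l -> exists2 p, v \in X p & p \in nbhd W l.
  move=> vA vl; apply: contrapT => nop; case: shared; exists v; split=> // t tW vt.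
  apply/eqP; apply: contrapT => /negP tl; case: nop.
  have [|||p] := cut_connected_leaf_nbr leafl _ (conX v vA) _ _ tl.
  - by apply/subsetP=> s; rewrite inE => /andP[].
  - by rewrite inE lW.
  - by rewrite inE tW.
  by rewrite inE => /andP[_ vp] pl; exists p.
have nbrW p : p \in nbhd W l -> p \in W :\ l.
  rewrite !inE => /andP[-> lp]; rewrite andbT.
  by apply: contraTneq lp => ->; rewrite adj_irrefl.
apply: (IHn (W :\ l)).
- by rewrite (cardsD1 l W) lW in cW.
- move=> v vA; have [t tW vt] := covV v vA.
  have [tl|tl] := eqVneq t l; last by exists t; rewrite // !inE tl.
  have [|p vp /nbrW pl] := other v vA; first by rewrite -tl.
  by exists p.
- move=> u v uA vA uv; have [t tW /andP[ut vt]] := covE u v uA vA uv.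
  have [tl|tl] := eqVneq t l; last by exists t; rewrite ?ut // !inE tl.
  rewrite {}tl in ut vt.
  (* Two vertices sharing the leaf bag also share the bag of the unique neighbour of [l]. *)
  have [p up pl] := other u uA ut; have [q vq ql] := other v vA vt.
  exists p; first exact: nbrW.
  by rewrite up (uniql p q).
- move=> u uA.
  have -> : [set t in W :\ l | u \in X t] = [set t in W | u \in X t] :\ l.
    by apply/setP=> t; rewrite !inE andbA.
  apply: cut_connected_leaf leafl _ (conX u uA).
  by apply/subsetP=> s; rewrite inE => /andP[].
Qed.

(** * Low-degree vertices and edge counts *)

(** Cliques are bounded only inside [A], since an element of the cover may contain cliques larger
    than those of the subgraph under study. *)
Lemma low_degree_vertex (H : sgraph) (k w : nat) (A : {set H}) :
  tree_independence_number H <= k -> A != set0 ->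
  (forall B : {set H}, B \subset A -> clique B -> #|B| <= w) ->
  exists2 v, v \in A & #|nbhd A v| <= w.+1 ^ k.
Proof.
rewrite /tree_independence_number.
case: ex_minnP => m /asboolP[T [X [[[_ _ acT] covV covE conX] <-]]] _ Xk An0 clA.
have [||u|v vA [t NX]] := @simplicial_bag H T X setT A acT An0.
- by move=> u _; have [t ut] := covV u; exists t; rewrite ?inE.
- by move=> u v _ _ /covE[t uvt]; exists t; rewrite ?inE.
- move=> _; suff -> : [set t in setT | u \in X t] = [set t | u \in X t].
    exact: connected_cut.
  by apply/setP=> t; rewrite !inE.
(* Ramsey applies to [nbhd A v]: cliques are bounded through [A], independent sets through the bag
   [X t]. *)
exists v => //; apply/ltnW/ramsey_bound => B BN.
  by apply: clA; apply: subset_trans BN _; apply/subsetP=> y; rewrite inE => /andP[].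
move/(independent_le_induced (subset_trans BN NX)) => /leq_trans; apply.
by apply: leq_trans Xk; apply: (@leq_bigmax T (fun t => independence_number (induced (X t)))).
Qed.

Lemma low_degree_vertex_induced (G : sgraph) (k w : nat) (C A : {set G}) :
  tree_independence_number (induced C) <= k -> A \subset C -> A != set0 ->
  (forall B : {set G}, B \subset A -> clique B -> #|B| <= w) ->
  exists2 v, v \in A & #|nbhd A v| <= w.+1 ^ k.
Proof.
move=> tinC AC An0 clA.
have valA : val @: restrict_set C A = A.
  apply/setP=> x; apply/imsetP/idP => [[z zA ->]|xA]; first by rewrite inE in zA.
  by exists (exist _ x (subsetP AC _ xA)); rewrite ?inE.
have [||v vA] := @low_degree_vertex _ k w (restrict_set C A) tinC.
- by apply: contraNneq An0 => A0; rewrite -valA A0 imset0.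
- move=> B BA /cliqueP clB; rewrite -(card_imset (mem B) val_inj); apply: clA.
    by rewrite -valA imsetS.
  by apply/cliqueP=> _ _ /imsetP[x xB ->] /imsetP[y yB ->] xy; apply: clB.
rewrite card_nbhd_induced valA; exists (val v) => //.
by rewrite inE in vA.
Qed.

(** Twice the number of edges spanned by [A]. *)
Definition degree_sum (G : sgraph) (A : {set G}) : nat :=
  \sum_(x in A) #|nbhd A x|.

(** An index set independent of [A] lets this sum be exchanged with a sum over a cover. *)
Lemma degree_sumE (G : sgraph) (A : {set G}) :
  degree_sum A = \sum_x \sum_y [&& x \in A, y \in A & adj x y].
Proof.
rewrite /degree_sum big_mkcond; apply: eq_bigr => x _.
case: (x \in A); last by rewrite big1.
rewrite -sum1_card big_mkcond; apply: eq_bigr => y _.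
by rewrite inE /=; case: andb.
Qed.

(** Deleting a vertex of degree at most [d] lowers the sum by twice its degree: once for itself,
    once through its neighbours. *)
Lemma degree_sum_le (G : sgraph) (d : nat) (A : {set G}) :
  (forall B : {set G}, B \subset A -> B != set0 ->
     exists2 v, v \in B & #|nbhd B v| <= d) ->
  degree_sum A <= 2 * d * #|A|.
Proof.
have [n] := ubnP #|A|; elim: n A => // n IHn A cA low.
have [->|An0] := eqVneq A set0; first by rewrite /degree_sum big_set0.
have [v vA degv] := low A (subxx _) An0.
have IH : degree_sum (A :\ v) <= 2 * d * #|A :\ v|.
  apply: IHn => [|B BA]; first by rewrite (cardsD1 v A) vA in cA.
  by apply: low; apply: subset_trans BA (subsetDl _ _).
have rem x : #|nbhd A x| = adj x v + #|nbhd (A :\ v) x|.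
  rewrite (cardsD1 v (nbhd A x)) inE vA; congr (_ + _).
  by apply: eq_card => y; rewrite !inE andbA.
have degvE : \sum_(x in A | x != v) adj x v = #|nbhd A v|.
  rewrite -sum1_card [RHS]big_mkcond [LHS]big_mkcond; apply: eq_bigr => x _.
  rewrite inE (adj_sym v x); case: eqVneq => [->|_]; first by rewrite adj_irrefl !andbF.
  by rewrite andbT; case: (x \in A); case: (adj x v).
rewrite /degree_sum (bigD1 v) //= (eq_bigr _ (fun x _ => rem x)) big_split /= degvE.
have -> : \sum_(x in A | x != v) #|nbhd (A :\ v) x| = degree_sum (A :\ v).
  by apply: eq_bigl => x; rewrite !inE andbC.
by rewrite (cardsD1 v A) vA; nia.
Qed.

(* An edge misses at most [2 * (1/4)] of a 3/4-general cover. *)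
Lemma cover_edge (G : sgraph) (C : seq {set G}) (x y : G) :
  (forall v : G, 3 * size C <= 4 * count (fun A : {set G} => v \in A) C) ->
  size C <= 2 * count (fun A : {set G} => (x \in A) && (y \in A)) C.
Proof.
move=> cov.
have := count_predUI (fun A : {set G} => x \in A) (fun A => y \in A) C.
have := count_size (predU (fun A : {set G} => x \in A) (fun A => y \in A)) C.
have -> : count (predI (fun A : {set G} => x \in A) (fun A => y \in A)) C =
  count (fun A : {set G} => (x \in A) && (y \in A)) C by [].
by have := cov x; have := cov y; lia.
Qed.

(** Double counting of adjacent pairs of [B] against the elements of the cover containing both
    ends. *)
Lemma cover_degree_sum (G : sgraph) (C : seq {set G}) (d : nat) (B : {set G}) :
  C <> [::] ->
  (forall v : G, 3 * size C <= 4 * count (fun A : {set G} => v \in A) C) ->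
  (forall A : {set G}, A \in C -> degree_sum (A :&: B) <= d * #|B|) ->
  degree_sum B <= 2 * d * #|B|.
Proof.
move=> Cn0 cov sparse.
have sC : 0 < size C by case: (C) Cn0.
rewrite -(leq_pmul2l sC).
have upper : \sum_(A <- C) degree_sum (A :&: B) <= size C * (d * #|B|).
  have -> : size C * (d * #|B|) = \sum_(A <- C) d * #|B|.
    by rewrite big_const_seq count_predT iter_addn_0 mulnC.
  by rewrite big_seq [leqRHS]big_seq; apply: leq_sum.
have lower : size C * degree_sum B <= 2 * \sum_(A <- C) degree_sum (A :&: B).
  under [X in 2 * X]eq_bigr do rewrite degree_sumE.
  rewrite exchange_big /= degree_sumE !big_distrr; apply: leq_sum => x _ /=.
  rewrite exchange_big /= !big_distrr; apply: leq_sum => y _ /=.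
  case xyB: [&& x \in B, y \in B & adj x y]; last by rewrite muln0.
  case/and3P: xyB => xB yB xy; rewrite muln1.
  apply: leq_trans (cover_edge x y cov) _; rewrite leq_mul2l /=.
  rewrite -sum1_count big_mkcond; apply: leq_sum => A _.
  by rewrite !inE xB yB xy !andbT; case: andb.
by apply: leq_trans lower _; nia.
Qed.

(** * Degeneracy and the conclusion *)

Lemma min_degree_le (G : sgraph) (x : G) : min_degree G <= degree x.
Proof.
rewrite /min_degree; have : x \in index_enum G by rewrite mem_index_enum.
elim: (index_enum G) => // y s IHs; rewrite inE big_cons geq_min.
by case/predU1P=> [->|/IHs->]; rewrite ?leqnn ?orbT.
Qed.

Lemma degeneracy_le (G : sgraph) (S : {set G}) (d : nat) :
  (forall B : {set G}, B \subset S -> B != set0 ->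
     exists2 v, v \in B & #|nbhd B v| <= d) ->
  degeneracy (induced S) <= d.
Proof.
move=> low; apply/bigmax_leqP => S' /set0Pn[z zS'].
(* The nested induced subgraph on [S'] is viewed as a vertex set of [G]. *)
have [||v /imsetP[x xS' ->] degx] := low (val @: S').
- by apply/subsetP=> _ /imsetP[y _ ->]; apply: valP.
- by apply/set0Pn; exists (val z); apply: imset_f.
apply: leq_trans (min_degree_le (exist _ x xS' : induced S')) _.
rewrite -card_nbhd_induced in degx; apply: leq_trans degx.
rewrite /degree -(card_imset (mem [set y | _]) val_inj); apply/subset_leq_card.
by apply/subsetP=> _ /imsetP[y + ->]; rewrite !inE (valP y).
Qed.

Theorem corollary6p7 (R : realType) (GG : graph_class) :
  frac_tree_independence_fragile R GG -> poly_dgn_omega_bounded R GG.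
Proof.
case=> f [_ fragile]; pose k := f 4.
(* Parameter 4 gives 3/4-general covers. In the factor 4, one 2 comes from counting each edge at
   both ends, the other from edges lying in only half of the cover. *)
exists (4%:R *: ('X + 1) ^+ k)%R => G GGG S _; set w := clique_number _.
rewrite !hornerE natr1 -natrX -natrM ler_nat.
have [C [[Cn0 cov] tinC]] := fragile 4 isT G GGG.
have covN v : 3 * size C <= 4 * count (fun A : {set G} => v \in A) C.
  by rewrite -(ler_nat R) !natrM; have := cov v; lra.
apply: degeneracy_le => B BS Bn0.
have clB (A : {set G}) : A \subset B -> clique A -> #|A| <= w.
  by move=> AB; apply: clique_le_induced; apply: subset_trans BS.
have sumB : degree_sum B <= 2 * (2 * w.+1 ^ k) * #|B|.
  apply: cover_degree_sum Cn0 covN _ => A AC.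
  apply: leq_trans (degree_sum_le (d := w.+1 ^ k) _) _ => [D DA Dn0|].
    move: DA; rewrite subsetI => /andP[DA DB].
    apply: low_degree_vertex_induced (tinC A AC) DA Dn0 _ => D' D'D.
    by apply: clB; apply: subset_trans DB.
  by rewrite leq_mul2l subset_leq_card ?orbT ?subsetIr.
(* The average degree in [B] is at most [4 * w.+1 ^ k], so not all degrees exceed it. *)
apply: contrapT => high; move: sumB; apply/negP; rewrite -ltnNge.
have hi x : x \in B -> (4 * w.+1 ^ k).+1 <= #|nbhd B x|.
  by move=> xB; rewrite ltnNge; apply/negP=> xd; apply: high; exists x.
have : \sum_(x in B) (4 * w.+1 ^ k).+1 <= degree_sum B by apply: leq_sum.
by move: Bn0; rewrite sum_nat_const -card_gt0; nia.
Qed.
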